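(* Let $R$ be an associative ring and let $P$ be a prime ideal of $R$. Suppose $R$ admits a generalized derivation $F$ with associated derivation $d$ satisfying any one of the following conditions (where in each condition $\pm$ denotes a fixed choice of sign, either choice being allowed): (i) $F(xy)\pm xy\in P$ for all $x,y\in R$; (ii) $F(xy) \pm yx \in P$ for all $x,y\in R$; (iii) $F(x)F(y) \pm xy \in P$ for all $x,y\in R$; (iv) $F(x)F(y) \pm yx \in P$ for all $x,y\in R$. Then either $R/P$ is a commutative integral domain or $d(R)\subseteq P$.
   Context: Rings are associative, and are not assumed to be commutative or to have a unity. Accordingly, ''commutative integral domain'' means a nonzero commutative ring without nonzero zero divisors (a unity is not required). A proper (two-sided) ideal $P$ of $R$ is prime if for any $x,y\in R$, $xRy\subseteq P$ implies $x\in P$ or $y\in P$. A derivation of $R$ is an additive map $d:R\to R$ with $d(xy)=d(x)y+xd(y)$ for all $x,y\in R$. A generalized derivation with associated derivation $d$ (where $d$ is a derivation of $R$) is an additive map $F:R\to R$ such that $F(xy)=F(x)y+xd(y)$ for all $x,y\in R$. *)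

(* Defs.v *)
From HB Require Import structures.
From mathcomp Require Import all_boot all_order all_algebra.
From mathcomp Require Import boolp classical_sets.

Set Implicit Arguments.
Unset Strict Implicit.
Unset Printing Implicit Defensive.

Import GRing.Theory.

(* MathComp's pzRingType and nzRingType have a unity, so associative rings not
   necessarily having one are introduced here. *)
HB.mixin Record Zmodule_isRng R of GRing.Zmodule R := {
  rngmul : R -> R -> R;
  rngmulA : associative rngmul;
  rngmulDl : left_distributive rngmul +%R;
  rngmulDr : right_distributive rngmul +%R
}.

#[short(type="rngType")]
HB.structure Definition Rng := {R of Zmodule_isRng R & GRing.Zmodule R}.

(* "*" is reserved in ring_scope for the product of unital rings. *)
Notation "x ** y" := (rngmul x y)
  (at level 40, left associativity) : ring_scope.

Local Open Scope classical_set_scope.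
Local Open Scope ring_scope.
Local Open Scope quotient_scope.

Section RngTheory.
Variable R : rngType.
Implicit Types x y : R.

Lemma rngmul0r x : 0 ** x = 0.
Proof. by apply: (addrI (0 ** x)); rewrite -rngmulDl !addr0. Qed.

Lemma rngmulr0 x : x ** 0 = 0.
Proof. by apply: (addrI (x ** 0)); rewrite -rngmulDr !addr0. Qed.

Lemma rngmulrN x y : x ** - y = - (x ** y).
Proof. by apply: (addrI (x ** y)); rewrite -rngmulDr !subrr rngmulr0. Qed.

Lemma rngmulNr x y : - x ** y = - (x ** y).
Proof. by apply: (addrI (x ** y)); rewrite -rngmulDl !subrr rngmul0r. Qed.

Lemma rngmulrBr x y z : x ** (y - z) = x ** y - x ** z.
Proof. by rewrite rngmulDr rngmulrN. Qed.

Lemma rngmulrBl x y z : (x - y) ** z = x ** z - y ** z.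
Proof. by rewrite rngmulDl rngmulNr. Qed.

End RngTheory.

HB.mixin Record isTwoSidedIdeal (R : rngType) (I : R -> Prop) := {
  rng_ideal0 : I 0;
  rng_idealB : forall x y, I x -> I y -> I (x - y);
  rng_idealMl : forall a x, I x -> I (a ** x);
  rng_idealMr : forall a x, I x -> I (x ** a)
}.

#[short(type="twoSidedIdeal")]
HB.structure Definition TwoSidedIdeal (R : rngType) :=
  {I of isTwoSidedIdeal R I}.

HB.mixin Record isPrimeTwoSidedIdeal (R : rngType) (I : R -> Prop) := {
  ideal_proper : exists x, ~ I x;
  ideal_prime : forall x y, (forall r, I (x ** r ** y)) -> I x \/ I y
}.

#[short(type="primeIdeal")]
HB.structure Definition PrimeTwoSidedIdeal (R : rngType) :=
  {I of isPrimeTwoSidedIdeal R I & TwoSidedIdeal R I}.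

Section RngQuotient.
Variables (R : rngType) (I : twoSidedIdeal R).

(* The additive quotient of ring_quotient takes boolean predicates. *)
Definition ideal_pred : {pred R} := fun x => `[< I x >].

Lemma ideal_pred_zmod_closed : zmod_closed ideal_pred.
Proof.
split; first exact/asboolP/rng_ideal0.
by move=> x y /asboolP Ix /asboolP Iy; apply/asboolP/rng_idealB.
Qed.

HB.instance Definition _ :=
  GRing.isZmodClosed.Build R ideal_pred ideal_pred_zmod_closed.

Definition rng_quot := @Quotient.quot R ideal_pred.

HB.instance Definition _ := ZmodQuotient.on rng_quot.

Lemma rng_quotP x y : reflect (I (x - y)) (x == y %[mod rng_quot]).
Proof. by rewrite -Quotient.idealrBE; exact: asboolP. Qed.

Lemma pi_rng_quotD : {morph \pi_rng_quot : x y / x + y >-> x + y}.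
Proof. exact: Quotient.pi_add. Qed.

Definition rng_quot_mul : rng_quot -> rng_quot -> rng_quot :=
  lift_op2 rng_quot (@rngmul R).

Lemma pi_rng_quot_mul :
  {morph \pi_rng_quot : x y / x ** y >-> rng_quot_mul x y}.
Proof.
move=> x y; unlock rng_quot_mul; apply/eqP/rng_quotP.
set x' := repr _; set y' := repr _.
have Ix : I (x - x') by apply/rng_quotP; rewrite reprK.
have Iy : I (y - y') by apply/rng_quotP; rewrite reprK.
have -> : x ** y - x' ** y' = (x - x') ** y - x' ** (y' - y).
  by rewrite rngmulrBl rngmulrBr opprB addrA subrK.
by apply: rng_idealB; [exact: rng_idealMr|apply: rng_idealMl; rewrite -opprB -sub0r;
  apply: rng_idealB => //; exact: rng_ideal0].
Qed.

Lemma rng_quot_mulA : associative rng_quot_mul.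
Proof.
move=> x y z; rewrite -[x]reprK -[y]reprK -[z]reprK.
by rewrite -!pi_rng_quot_mul rngmulA.
Qed.

Lemma rng_quot_mulDl : left_distributive rng_quot_mul +%R.
Proof.
move=> x y z; rewrite -[x]reprK -[y]reprK -[z]reprK.
by rewrite -!pi_rng_quot_mul -!pi_rng_quotD -!pi_rng_quot_mul rngmulDl.
Qed.

Lemma rng_quot_mulDr : right_distributive rng_quot_mul +%R.
Proof.
move=> x y z; rewrite -[x]reprK -[y]reprK -[z]reprK.
by rewrite -!pi_rng_quot_mul -!pi_rng_quotD -!pi_rng_quot_mul rngmulDr.
Qed.

HB.instance Definition _ := Zmodule_isRng.Build rng_quot
  rng_quot_mulA rng_quot_mulDl rng_quot_mulDr.

End RngQuotient.

Notation "R / I" := (@rng_quot R I) : type_scope.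

(* No unity is required. *)
Definition comm_integral_domain (S : rngType) : Prop :=
  [/\ exists x : S, x != 0,
      commutative (@rngmul S) &
      forall x y : S, x ** y = 0 -> x = 0 \/ y = 0].

Definition derivation (R : rngType) (d : {additive R -> R}) : Prop :=
  forall x y, d (x ** y) = d x ** y + x ** d y.

Definition generalized_derivation (R : rngType) (F d : {additive R -> R}) :
    Prop :=
  derivation d /\ forall x y, F (x ** y) = F x ** y + x ** d y.

(* Main.v *)
Require Import Defs.
From mathcomp Require Import all_boot all_order all_algebra.
From mathcomp Require Import boolp classical_sets.
Local Open Scope classical_set_scope.
Local Open Scope ring_scope.
Import GRing.Theory.

(** In every case the conclusion holds in the strong form [range d `<=` P].
Modulo [P], each hypothesis reads [B x y = m x y], where [B x y] is
[F (x ** y)] or [F x ** F y], and [m x y] is [x ** y] or [y ** x] up to sign.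
Replace [y] by [y ** x].  The right-hand side is only multiplied by [x] on the
right: this is clear for [x ** y], and for [y ** x] it is the reason for
multiplying by [x] itself rather than by an arbitrary [z].  The left-hand side
picks up in addition the term [g x ** y ** d x], with [g] the identity for
[F (x ** y)] and [g = F] for [F x ** F y].  This term therefore lies in [P] for
all [x] and [y] ([twisted_term_in_ideal]).

By primeness each [x] satisfies [P (g x)] or [P (d x)].  These two conditions
define additive subgroups covering [R], and a group is not the union of two
proper subgroups, so [g] or [d] maps all of [R] into [P]
([prime_ideal_additive_dichotomy]).  The former is impossible for [g] the
identity because [P] is proper; for [g = F] it would put all products in [P],
and then [P], being prime, would be everything ([prime_ideal_product_notin]). *)

Section TwoSidedIdealTheory.
Variables (R : rngType) (I : twoSidedIdeal R).

Lemma rng_idealN (x : R) : I x -> I (- x).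
Proof.
by move=> Ix; rewrite -sub0r; apply: rng_idealB => //; exact: rng_ideal0.
Qed.

Lemma rng_idealBK (x y : R) : I (x - y) -> I y -> I x.
Proof.
move=> Ixy /rng_idealN INy.
by rewrite -(subrK y x) -[X in _ + X]opprK; exact: rng_idealB.
Qed.

(** Expanding [B x (y ** x) - m x (y ** x)] and subtracting
[(B x y - m x y) ** x] leaves only the extra term. *)
Lemma twisted_term_in_ideal (B m : R -> R -> R) (g d : R -> R) :
    (forall x y, B x (y ** x) = B x y ** x + g x ** y ** d x) ->
    (forall x y, m x (y ** x) = m x y ** x) ->
    (forall x y, I (B x y - m x y)) ->
  forall x y, I (g x ** y ** d x).
Proof.
move=> BM mM IBm x y.
have -> : g x ** y ** d x =
    (B x (y ** x) - m x (y ** x)) - (B x y - m x y) ** x.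
  by rewrite BM mM rngmulrBl opprB addrA subrK addrAC subrr add0r.
by apply: rng_idealB => //; exact: rng_idealMr.
Qed.

End TwoSidedIdealTheory.

Section PrimeIdealTheory.
Variables (R : rngType) (P : primeIdeal R).

(** Otherwise [P (x ** r ** x)] for all [r], so primeness puts each [x] in [P],
which is proper. *)
Lemma prime_ideal_product_notin : ~ (forall x y : R, P (x ** y)).
Proof.
move=> PM; have [x Px] := ideal_proper (s := P).
by have [] := ideal_prime (s := P) x x (fun r => PM (x ** r) x).
Qed.

(** This is the fact that a group is not the union of two proper subgroups,
applied to the preimages of [P] under [f] and [g], which cover [R] by
primeness of [P]. *)
Lemma prime_ideal_additive_dichotomy (f g : {additive R -> R}) :
  (forall x y, P (f x ** y ** g x)) -> range f `<=` P \/ range g `<=` P.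
Proof.
move=> Pfg.
have cover x : P (f x) \/ P (g x) by apply: ideal_prime => r; exact: Pfg.
have [Pf|/existsNP[a Pfa]] := pselect (forall x, P (f x)).
  by left=> _ [x _ <-].
have Pga : P (g a) by case: (cover a).
right=> _ [x _ <-].
have [Pfx|//] := cover x.
(* Here [x] is in the preimage under [f] and [a] is not, so [a - x] is not. *)
have [|] := cover (a - x); rewrite raddfB => H.
  by case: Pfa; exact: rng_idealBK H Pfx.
by rewrite -(subKr (g a) (g x)); exact: rng_idealB.
Qed.

Lemma derivation_in_ideal_of_F_mul (F d : {additive R -> R})
    (m : R -> R -> R) :
    generalized_derivation F d ->
    (forall x y, m x (y ** x) = m x y ** x) ->
    (forall x y, P (F (x ** y) - m x y)) ->
  range d `<=` P.
Proof.
move=> [_ FM] mM PFm.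
have Pxyd : forall x y, P (x ** y ** d x).
  apply: (twisted_term_in_ideal R P (fun x y => F (x ** y)) m id d) => // x y.
  by rewrite rngmulA FM.
have [Pid|//] := prime_ideal_additive_dichotomy idfun d Pxyd.
have [x Px] := ideal_proper (s := P).
by case: Px; apply: Pid; exists x.
Qed.

(** If [F] mapped [R] into [P], the congruence would put every [m x y] in [P];
this is what the hypothesis on [m] excludes. *)
Lemma derivation_in_ideal_of_mul_F (F d : {additive R -> R})
    (m : R -> R -> R) :
    generalized_derivation F d ->
    (forall x y, m x (y ** x) = m x y ** x) ->
    ~ (forall x y, P (m x y)) ->
    (forall x y, P (F x ** F y - m x y)) ->
  range d `<=` P.
Proof.
move=> [_ FM] mM Nm PFm.
have PFyd : forall x y, P (F x ** y ** d x).
  apply: (twisted_term_in_ideal R P (fun x y => F x ** F y) m F d) => // x y.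
  by rewrite FM rngmulDr !rngmulA.
have [PF|//] := prime_ideal_additive_dichotomy F d PFyd.
case: Nm => x y; rewrite -(subKr (F x ** F y) (m x y)).
by apply: rng_idealB; [apply: rng_idealMr; apply: PF; exists x|exact: PFm].
Qed.

End PrimeIdealTheory.

Theorem theorem1p5 (R : rngType) (P : primeIdeal R)
    (F d : {additive R -> R}) (hF : generalized_derivation F d)
    (hFP :
      (forall x y : R, P (F (x ** y) + x ** y)) \/
      (forall x y : R, P (F (x ** y) - x ** y)) \/
      (forall x y : R, P (F (x ** y) + y ** x)) \/
      (forall x y : R, P (F (x ** y) - y ** x)) \/
      (forall x y : R, P (F x ** F y + x ** y)) \/
      (forall x y : R, P (F x ** F y - x ** y)) \/
      (forall x y : R, P (F x ** F y + y ** x)) \/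
      (forall x y : R, P (F x ** F y - y ** x))) :
  comm_integral_domain (R / P)%type \/ range d `<=` P.
Proof.
right.
have NPN (m : R -> R -> R) :
    ~ (forall x y, P (m x y)) -> ~ (forall x y, P (- m x y)).
  move=> Nm PNm; apply: Nm => x y.
  by rewrite -(opprK (m x y)); exact: (rng_idealN R P _ (PNm x y)).
have NPM := prime_ideal_product_notin R P.
have NPMop : ~ (forall x y : R, P (y ** x)) by move=> PM; apply: NPM.
case: hFP => [H|[H|[H|[H|[H|[H|[H|H]]]]]]].
- apply: (derivation_in_ideal_of_F_mul R P F d (fun x y => - (x ** y))) => // x y.
    by rewrite rngmulNr rngmulA.
  by rewrite opprK.
- apply: (derivation_in_ideal_of_F_mul R P F d (fun x y => x ** y)) => // x y.
  by rewrite rngmulA.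
- apply: (derivation_in_ideal_of_F_mul R P F d (fun x y => - (y ** x))) => // x y.
    by rewrite rngmulNr.
  by rewrite opprK.
- by apply: (derivation_in_ideal_of_F_mul R P F d (fun x y => y ** x)).
- apply: (derivation_in_ideal_of_mul_F R P F d (fun x y => - (x ** y))) => //.
  + by move=> x y; rewrite rngmulNr rngmulA.
  + exact: NPN.
  + by move=> x y; rewrite opprK.
- apply: (derivation_in_ideal_of_mul_F R P F d (fun x y => x ** y)) => // x y.
  by rewrite rngmulA.
- apply: (derivation_in_ideal_of_mul_F R P F d (fun x y => - (y ** x))) => //.
  + by move=> x y; rewrite rngmulNr.
  + exact: (NPN (fun x y => y ** x)).
  + by move=> x y; rewrite opprK.
- by apply: (derivation_in_ideal_of_mul_F R P F d (fun x y => y ** x)).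
Qed.
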